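(* Let $G$ be a group. If $G$ contains a wS-subset, then $G$ contains a free subgroup of rank two.
   Context: For a group $G$ and $g,h\in G$, a subset $E\subseteq G$ is a $(g,h)$-wS-subset if there exist elements $a\neq b$ in $E$ such that $gE=E\smallsetminus\{a\}$ and $hE=E\smallsetminus\{b\}$, where $gE=\{gx: x\in E\}$. A subset $E\subseteq G$ is a wS-subset (weak Sierpiński subset) if it is a $(g,h)$-wS-subset for some $g,h\in G$. *)

(* Defs.v *)
From HB Require Import structures.
From mathcomp Require Import all_boot.
From mathcomp Require Import monoid.
From mathcomp Require Import mathcomp_extra boolp classical_sets.

Set Implicit Arguments.
Unset Strict Implicit.
Unset Printing Implicit Defensive.

Local Open Scope classical_set_scope.
Local Open Scope group_scope.

Definition ltranslate (G : groupType) (g : G) (E : set G) : set G :=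
  [set g * x | x in E].

Definition wS_subset_for (G : groupType) (g h : G) (E : set G) : Prop :=
  exists a b : G, [/\ E a, E b, a <> b,
    ltranslate g E = E `\ a & ltranslate h E = E `\ b].

Definition wS_subset (G : groupType) (E : set G) : Prop :=
  exists g h : G, wS_subset_for g h E.

(* Universal property; it forces x to be injective, since there are
   nontrivial groups K.  A multiplicative map between groups preserves 1
   and inverses, so {multiplicative F -> K} is the type of homomorphisms. *)
Definition free_basis (I : Type) (F : groupType) (x : I -> F) : Prop :=
  forall (K : groupType) (f : I -> K),
    exists phi : {multiplicative F -> K},
      (forall i, phi (x i) = f i) /\
      (forall psi : {multiplicative F -> K},
          (forall i, psi (x i) = f i) -> psi =1 phi).

Definition free_of_rank (n : nat) (F : groupType) : Prop :=
  exists x : 'I_n -> F, free_basis x.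

(* A subGroupType S is the group structure carried by the subset S of G. *)
Definition contains_free_subgroup (n : nat) (G : groupType) : Prop :=
  exists (S : pred G) (H : subGroupType S), free_of_rank n H.

(* Main.v *)
Require Import Defs.
From HB Require Import structures.
From mathcomp Require Import all_boot monoid ssralg ssrnum ssrint intdiv zify.
From mathcomp Require Import boolp classical_sets.

Set Implicit Arguments.
Unset Strict Implicit.
Unset Printing Implicit Defensive.

Local Open Scope classical_set_scope.
Local Open Scope group_scope.

(**
Call F a g-cut at a when gF = F minus {a}.  A (g,h)-wS-subset E is at once a
g-cut and an h-cut: in the graph joining x to gx and to hx, its coboundary
consists of one g-edge and one h-edge.  Right translations are graph
automorphisms, so every g-edge has an h-edge as partner, and a simple cycle
through one of the two edges also traverses the other one, in the opposite
sense.

If g and h satisfy no relation, they generate a free group.  Otherwise the graph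
contains a simple cycle.  Choose a cut, a cycle and an orientation such that the
cycle enters the cut by the g-edge and leaves it by the h-edge after as few
vertices as possible.  If there is more than one vertex in between, the
edge following the g-edge and its partner bound a second cut.  Intersecting the
two cuts gives a shorter configuration, except for one pattern of orientations;
that pattern forces the cycle to read ghghgh..., with no edge traversed
backwards, and such a cycle does not leave the first cut.
Hence, possibly after replacing g and h by their inverses, some F is a g-cut and
an h-cut at the same point, so that u = g^-1 h is nontrivial and uF = F.

Finally, if F is a g-cut at a and uF = F with u <> 1, then g and u g u^-1 are
free generators: every g-edge is a bridge modulo the left stabilizer of F, and
a path given by a reduced word cannot cross the same bridge back.
*)

(** * Words and free subgroups *)

Section Words.
Variables (I : eqType).
Implicit Types (w : seq (I * bool)) (l : I * bool).

Definition letter (G : groupType) (f : I -> G) l : G :=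
  if l.2 then f l.1 else (f l.1)^-1.

Definition flip l := (l.1, ~~ l.2).

Definition reduced w := sorted (fun l l' => l' != flip l) w.

Definition weval (G : groupType) (f : I -> G) w : G :=
  foldr (fun l z => letter f l * z) 1 w.

Definition independent (G : groupType) (f : I -> G) :=
  forall w, w != [::] -> reduced w -> weval f w <> 1.

Lemma letter_flip (G : groupType) (f : I -> G) l :
  letter f (flip l) = (letter f l)^-1.
Proof. by case: l => i [] //=; rewrite /letter /= invgK. Qed.

Lemma weval_cat (G : groupType) (f : I -> G) w1 w2 :
  weval f (w1 ++ w2) = weval f w1 * weval f w2.
Proof. by elim: w1 => [|l w1 IH] /=; rewrite ?mul1g // IH mulgA. Qed.

Lemma weval_inv (G : groupType) (f : I -> G) w :
  weval f (map flip (rev w)) = (weval f w)^-1.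
Proof.
elim: w => [|l w IH] /=; first by rewrite invg1.
by rewrite rev_cons map_rcons -cats1 weval_cat /= IH letter_flip mulg1 invgM.
Qed.

Lemma eq_weval (G : groupType) (f f' : I -> G) w :
  f =1 f' -> weval f w = weval f' w.
Proof. by move=> e; elim: w => //= l w ->; rewrite /letter e. Qed.

Lemma gmulf_weval (G K : groupType) (phi : {multiplicative G -> K}) f w :
  phi (weval f w) = weval (phi \o f) w.
Proof.
have phi1 : phi 1 = 1 by apply: (mulgI (phi 1)); rewrite -gmulfM !mulg1.
have phiV x : phi x^-1 = (phi x)^-1.
  by apply: (mulgI (phi x)); rewrite -gmulfM !mulgV.
elim: w => [|[i s] w IH] //=.
by rewrite gmulfM IH; case: s; rewrite /letter /= ?phiV.
Qed.

Lemma not_reduced w :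
  ~~ reduced w -> exists w1 l w2, w = w1 ++ [:: l, flip l & w2].
Proof.
elim: w => [//|l [//|l' w] IH]; rewrite /reduced /= negb_and negbK.
case/orP => [/eqP->|/IH[w1 [k [w2 ->]]]]; first by exists [::], l, w.
by exists (l :: w1), k, w2.
Qed.

(** A nonempty relation of an independent family is not reduced, so it contains some [l], [flip l];
    cancelling this pair preserves the value under [f'] too. *)
Lemma independent_relation (G K : groupType) (f : I -> G) (f' : I -> K) w :
  independent f -> weval f w = 1 -> weval f' w = 1.
Proof.
move=> ind; have [n] := ubnP (size w).
elim: n w => // n IH w lt_w w1.
have [red|/not_reduced[w2 [l [w3 e]]]] := boolP (reduced w).
  by case: (eqVneq w [::]) => [->//|/ind /(_ red)].
have red2 (H : groupType) (k : I -> H) : weval k w = weval k (w2 ++ w3).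
  by rewrite e !weval_cat /= letter_flip mulVKg.
rewrite red2; apply: IH; last by rewrite -red2.
by move: lt_w; rewrite e !size_cat /=; lia.
Qed.

Section GeneratedSubgroup.
Variables (G : groupType) (f : I -> G).

Definition generated : pred G := fun z => `[< exists w, weval f w = z >].

Lemma generatedP z : reflect (exists w, weval f w = z) (z \in generated).
Proof. exact: asboolP. Qed.

Lemma generated_group_closed : group_closed generated.
Proof.
split; first by apply/generatedP; exists [::].
move=> x y /generatedP[w <-] /generatedP[w' <-]; apply/generatedP.
by exists (w ++ map flip (rev w')); rewrite weval_cat weval_inv.
Qed.

Definition generated_type := {z : G | generated z}.
HB.instance Definition _ := SubChoice.on generated_type.
HB.instance Definition _ :=
  SubChoice_isSubGroup.Build G generated generated_type generated_group_closed.

Definition generated_group : subGroupType generated := generated_type.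

Lemma generated_gen i : generated (f i).
Proof. by apply/generatedP; exists [:: (i, true)]; rewrite /= mulg1. Qed.

Definition generator i : generated_group := Sub (f i) (generated_gen i).

Lemma val_weval_generator w : val (weval generator w) = weval f w.
Proof.
by rewrite (gmulf_weval (\val : {multiplicative generated_group -> G})).
Qed.

(** An arbitrary choice of word; independence makes its value in another group insensitive to the
    choice. *)
Definition word_of (z : generated_group) : seq (I * bool) :=
  sval (cid (elimT (generatedP (val z)) (valP z))).

Lemma weval_word_of z : weval f (word_of z) = val z.
Proof. by rewrite /word_of; case: cid. Qed.

Hypothesis ind : independent f.

Lemma independent_free_basis : free_basis generator.
Proof.
move=> K k.
have wd w z : weval f w = val z -> weval k (word_of z) = weval k w.
  move=> wz; apply: divg1_eq; rewrite -weval_inv -weval_cat.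
  apply: (independent_relation _ ind).
  by rewrite weval_cat weval_inv weval_word_of wz mulgV.
have phiM : {morph (fun z => weval k (word_of z)) : x y / x * y}.
  by move=> x y; rewrite -weval_cat; apply: wd;
    rewrite weval_cat !weval_word_of valM.
pose phiMul := isMultiplicative.Build generated_group K _ phiM.
pose phi : {multiplicative generated_group -> K} :=
  HB.pack (fun z => weval k (word_of z)) phiMul.
exists phi; split=> [i|psi psiE z].
  by rewrite /= (wd [:: (i, true)]) /= mulg1 // SubK.
suff psiw w : psi (weval generator w) = weval k w.
  rewrite -[z in LHS](_ : weval generator (word_of z) = z) ?psiw //.
  by apply: val_inj; rewrite val_weval_generator weval_word_of.
by rewrite gmulf_weval; apply: eq_weval.
Qed.

End GeneratedSubgroup.
End Words.

Lemma independent_contains_free (n : nat) (G : groupType) (f : 'I_n -> G) :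
  independent f -> contains_free_subgroup n G.
Proof.
move=> ind; exists (generated f), (generated_group f), (generator f).
exact: independent_free_basis.
Qed.

(** * Cuts *)

(** In the graph: exactly one [g]-edge has a single end in [F], namely the one ending at [a], and it
    points into [F]. *)
Definition cuts (G : groupType) (g : G) (F : set G) (a : G) :=
  F a /\ forall x, F x <-> F (g * x) /\ g * x <> a.

Definition stabilizes (G : groupType) (F : set G) (u : G) :=
  forall x, F (u * x) <-> F x.

Section Cuts.
Variable G : groupType.
Implicit Types (g h u x y z a b : G) (F E : set G).

Lemma ltranslate_cuts g F a : F a -> ltranslate g F = F `\ a -> cuts g F a.
Proof.
move=> Fa eF; split=> // x; split=> [Fx|].
  by have: ltranslate g F (g * x) by [exists x]; rewrite eF.
case=> Fgx nea; have: (F `\ a) (g * x) by [].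
by rewrite -eF => -[y Fy /mulgI <-].
Qed.

Lemma cuts_step g F a x : cuts g F a -> F x -> F (g * x).
Proof. by case=> _ gF /gF[]. Qed.

Lemma cuts_enter g F a x : cuts g F a -> ~ F x -> F (g * x) -> g * x = a.
Proof. by case=> _ gF nFx Fgx; apply: contrapT => ne; apply/nFx/gF. Qed.

Lemma cuts_source g F a x : cuts g F a -> g * x = a -> ~ F x.
Proof. by case=> _ gF e /gF[]. Qed.

Lemma cuts_translate g F a z :
  cuts g F a -> cuts g [set x | F (x * z)] (a * z^-1).
Proof.
move=> [Fa gF]; split=> [|x] /=; first by rewrite mulgVK.
rewrite gF mulgA; split=> -[Fg ne]; split=> // e; apply: ne.
  by rewrite e mulgVK.
by rewrite -e mulgK.
Qed.

Lemma cuts_translate_to g F a a' :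
  cuts g F a -> cuts g [set x | F (x * (a'^-1 * a))] a'.
Proof.
by move=> /(cuts_translate (a'^-1 * a)); rewrite invgM mulVKg invgK.
Qed.

Lemma cuts_translate2 g h F a b a' : cuts g F a -> cuts h F b ->
  exists F' b', cuts g F' a' /\ cuts h F' b'.
Proof.
move=> /(cuts_translate_to a') gF /(cuts_translate (a'^-1 * a)) hF.
by do 2 eexists; split; [exact: gF|exact: hF].
Qed.

Lemma cuts_compl g F a : cuts g F a -> cuts g^-1 (~` F) (g^-1 * a).
Proof.
move=> cF; split=> [|x] /=; first by apply: (cuts_source cF); rewrite mulVKg.
have [_ /(_ (g^-1 * x))] := cF; rewrite mulVKg => gF; split=> [nF|[nF ne] Fx].
  split=> [/gF[]//|/mulgI e]; by case: cF nF; rewrite e.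
by apply: nF; apply/gF; split=> // e; apply: ne; rewrite e.
Qed.

(** The edge into [a1] has both ends outside [F], so only the edge into [a] remains on the
    boundary. *)
Lemma cuts_setI g F a F1 a1 : cuts g F a -> cuts g F1 a1 ->
  F1 a -> ~ F a1 -> cuts g (F `&` F1) a.
Proof.
move=> [Fa gF] [_ gF1] F1a nFa1; split=> // x; split.
  by case=> /gF[Fgx ne] /gF1[F1gx _].
case=> -[Fgx F1gx] ne; split; first exact/gF.
by apply/gF1; split=> // e; apply: nFa1; rewrite -e.
Qed.

Lemma cuts_setD g F a F1 a1 : cuts g F a -> cuts g F1 a1 ->
  ~ F1 a -> ~ F a1 -> cuts g (F `\` F1) a.
Proof.
move=> [Fa gF] gF1 nF1a nFa1; split=> // x; split.
  case=> /gF[Fgx ne] nF1x; split=> //; split=> // F1gx.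
  by apply: nFa1; rewrite -(cuts_enter gF1 nF1x F1gx).
case=> -[Fgx nF1gx] ne; split; first exact/gF.
by move=> /(cuts_step gF1).
Qed.

Lemma cuts_mul_neq1 g h F a b : cuts g F a -> cuts h F b -> g * h <> 1.
Proof.
move=> gF hF e; have [Fa _] := gF; have := cuts_step hF Fa.
by apply: (cuts_source gF); rewrite mulgA e mul1g.
Qed.

Lemma stabilizes_divl g h F a :
  cuts g F a -> cuts h F a -> stabilizes F (g^-1 * h).
Proof.
by move=> [_ gF] [_ hF] x; rewrite gF -!mulgA mulVKg -hF.
Qed.

Lemma stabilizesV F u : stabilizes F u -> stabilizes F u^-1.
Proof. by move=> uF x; rewrite -uF mulVKg. Qed.

Lemma stabilizesM F u z :
  stabilizes F u -> stabilizes F z -> stabilizes F (u * z).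
Proof. by move=> uF zF x; rewrite -mulgA uF zF. Qed.

End Cuts.

(** * Free generators from a cut with a nontrivial stabilizer *)

Section ConjugateFamily.
Variables (G : groupType) (I : eqType) (g a : G) (E : set G) (t : I -> G).
Hypotheses (gE : cuts g E a) (tE : forall i, stabilizes E (t i)).
Hypothesis t_inj : injective t.

Let f i := t i * g * (t i)^-1.

Lemma weval_exit (P : set G) w : P 1 -> ~ P (weval f w) ->
  exists w1 l w2, [/\ w = w1 ++ l :: w2, P (weval f w2)
                    & ~ P (letter f l * weval f w2)].
Proof.
move=> P1; elim: w => [//|l w IH] /= nP.
have [Pw|nPw] := pselect (P (weval f w)); first by exists [::], l, w.
by have [w1 [l' [w2 [-> ? ?]]]] := IH nPw; exists (l :: w1), l', w2.
Qed.

(** Right translations and complements preserve left stabilizers, so the bridge can be moved to any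
    point and given either direction. *)
Lemma signed_cut (s : bool) b : exists F,
  cuts (if s then g else g^-1) F b /\
  (forall u, stabilizes E u -> stabilizes F u).
Proof.
case: s.
  exists [set x | E (x * (b^-1 * a))]; split.
    exact: cuts_translate_to.
  by move=> u uE x; rewrite /= -mulgA uE.
exists [set x | (~` E) (x * (b^-1 * (g^-1 * a)))]; split.
  by apply: cuts_translate_to; apply: cuts_compl.
by move=> u uE x; rewrite /= -mulgA uE.
Qed.

Lemma letter_conj i (s : bool) :
  letter f (i, s) = t i * (if s then g else g^-1) * (t i)^-1.
Proof. by case: s; rewrite /letter //= /f !invgM invgK mulgA. Qed.

(* Two passages through the same bridge enclose a subword whose value lies in
   the stabilizer but need not be 1, so the induction must exclude all of it. *)
Lemma weval_conj_stab w :
  w != [::] -> reduced w -> ~ stabilizes E (weval f w).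
Proof.
have [n] := ubnP (size w); elim: n w => // n IH [//|[i s] w] lt_w _ red uE.
set gs := if s then g else g^-1.
(* The leftmost letter acts last; after [(t i)^-1] it crosses the [gs]-edge ending at [b]. *)
pose b := gs * (t i)^-1 * weval f w.
have tb : t i * b = weval f ((i, s) :: w) by rewrite /= letter_conj /b !mulgA.
have [F [gF sF]] := signed_cut s b; rewrite -/gs in gF.
have F1 : F 1.
  by case: gF => Fb _; apply/(sF _ uE); rewrite mulg1 -tb; apply/(sF _ (tE i)).
have nFw : ~ F (weval f w).
  move=> /(sF _ (stabilizesV (tE i))); apply: (cuts_source gF).
  by rewrite /b !mulgA.
(* The path to [weval f w] starts in [F] and ends outside; up to the stabilizer, it can only leave
   by crossing the edge into [b] backwards. *)
have [w1 [[j s'] [w2 [ew Fw2 nFw2]]]] := weval_exit F1 nFw.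
rewrite letter_conj in nFw2.
have ss' : s' = ~~ s.
  apply: contra_notP nFw2 => ns.
  have -> : s' = s by move: ns; case: (s'); case: (s).
  rewrite -/gs -!mulgA; apply/(sF _ (tE j)); apply: (cuts_step gF).
  exact/(sF _ (stabilizesV (tE j))).
have gs' : (if s' then g else g^-1) = gs^-1.
  by rewrite ss' /gs; case: (s); rewrite ?invgK.
have xb : weval f w2 = t j * b.
  rewrite gs' in nFw2.
  apply: (mulgI (t j)^-1); rewrite mulKg.
  have := cuts_enter (x := gs^-1 * (t j)^-1 * weval f w2) gF.
  rewrite -!mulgA !mulVKg; apply.
    by move=> Fx; apply: nFw2; rewrite -!mulgA; apply/(sF _ (tE j)).
  exact/(sF _ (stabilizesV (tE j))).
have bE : stabilizes E b.
  by have := stabilizesM (stabilizesV (tE i)) uE; rewrite -tb mulKg.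
have red' : reduced w by move: red; rewrite /reduced /= => /path_sorted.
have red_l : reduced w1.
  by move: red'; rewrite /reduced ew => /cat_sorted2[].
have red_r : reduced w2.
  by move: red'; rewrite /reduced ew => /cat_sorted2[_] /= /path_sorted.
(* First [w2], then [w1] has its value in the stabilizer, so induction leaves both empty; the
   remaining two letters cancel. *)
have [w20|w2n] := eqVneq w2 [::]; last first.
  apply: (IH _ _ w2n red_r); last by rewrite xb; apply: stabilizesM.
  by move: lt_w; rewrite ew /= size_cat /=; lia.
have w1E : weval f w1 = t i * (t j)^-1.
  move: xb; rewrite w20 /= => xb.
  have bj : b = (t j)^-1 by apply: (mulgI (t j)); rewrite mulgV.
  move: bj; rewrite /b ew w20 weval_cat /= letter_conj gs' mulg1 => bj.
  apply: (mulgI (t i)^-1); rewrite mulKg.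
  apply: (mulgI gs); apply: (mulIg (t j * gs^-1 * (t j)^-1)).
  by rewrite !mulgA mulgVK -!mulgA in bj *; rewrite bj !mulgA mulgV mul1g.
have [w10|w1n] := eqVneq w1 [::]; last first.
  apply: (IH _ _ w1n red_l).
    by move: lt_w; rewrite ew /= size_cat /=; lia.
  by rewrite w1E; apply: stabilizesM => //; apply: stabilizesV.
have ij : i = j by apply/t_inj/divg1_eq; rewrite -w1E w10.
by move: red; rewrite ew w10 w20 ij ss' /reduced /= eqxx.
Qed.

Lemma conjugates_independent : independent f.
Proof.
move=> w wn red w1; apply: (weval_conj_stab wn red).
by move=> x; rewrite w1 mul1g.
Qed.

End ConjugateFamily.

(** * Cycles *)

Lemma first_exit (P : int -> Prop) (i j : int) : (i < j)%R ->
  P i -> ~ P j ->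
  exists k : int, [/\ (i <= k < j)%R, ~ P (k + 1)%R
                    & forall m : int, (i <= m <= k)%R -> P m].
Proof.
move=> ij Pi nPj.
have ex : exists n, `[< ~ P (i + n.+1%:Z)%R >].
  exists `|j - i|.-1; apply/asboolP.
  by rewrite (_ : (i + _)%R = j) //; lia.
case: (ex_minnP ex) => n /asboolP nPn minn.
have Pm (m : int) : (i <= m <= i + n%:Z)%R -> P m.
  move=> im; apply: contrapT => nPm.
  have ne : m <> i by move=> e; apply: nPm; rewrite e.
  have /minn : `[< ~ P (i + (`|m - i|.-1).+1%:Z)%R >]; last lia.
  by apply/asboolP; rewrite (_ : (i + _)%R = m) //; lia.
exists (i + n%:Z)%R; split=> //.
  have [//|nj] : (i + n%:Z < j)%R \/ (j <= i + n%:Z)%R by lia.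
    lia.
  by case: nPj; apply: Pm; lia.
by rewrite (_ : (_ + 1)%R = (i + n.+1%:Z)%R) //; lia.
Qed.

Section Cycles.
Variable G : groupType.
Implicit Types (g h u x y z a b : G) (F E : set G) (L i j k : int).
Implicit Type v : int -> G.

Definition joined g x y := y = g * x \/ x = g * y.

(** Periodic indexing by all integers makes reversal a mere negation of indices; [3 <= L] excludes
    going back and forth along one edge. *)
Definition cayley_cycle L v g h :=
  [/\ (3 <= L)%R, forall i, v (i + L)%R = v i,
      forall i j, (i < j < i + L)%R -> v i <> v j
    & forall i, joined g (v i) (v (i + 1)%R) \/ joined h (v i) (v (i + 1)%R)].

Lemma joinedC g x y : joined g x y -> joined g y x.
Proof. by case; [right|left]. Qed.

Lemma joinedV g x y : joined g x y -> joined g^-1 x y.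
Proof. by case=> ->; rewrite /joined mulKg; [right|left]. Qed.

Lemma cayley_cycle_swap L v g h : cayley_cycle L v g h -> cayley_cycle L v h g.
Proof. by case=> ? ? ? adj; split=> // i; case: (adj i); [right|left]. Qed.

Lemma cayley_cycle_rev L v g h :
  cayley_cycle L v g h -> cayley_cycle L (fun i => v (- i)%R) g h.
Proof.
move=> [L3 per inj adj]; split=> // [i|i j ij e|i].
- by rewrite -(per (- (i + L))%R); congr v; lia.
- by apply: (inj (- j)%R (- i)%R); [lia|].
have := adj (- (i + 1))%R; rewrite (_ : (- (i + 1) + 1)%R = (- i)%R); last lia.
by case=> /joinedC; [left|right].
Qed.

Lemma cayley_cycle_invr L v g h :
  cayley_cycle L v g h -> cayley_cycle L v g h^-1.
Proof.
move=> [L3 per inj adj]; split=> // i.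
by case: (adj i) => [|/joinedV]; [left|right].
Qed.

Lemma cayley_cycle_invl L v g h :
  cayley_cycle L v g h -> cayley_cycle L v g^-1 h.
Proof. by move=> /cayley_cycle_swap/cayley_cycle_invr/cayley_cycle_swap. Qed.

Lemma cayley_cycle_inj L v g h i j : cayley_cycle L v g h ->
  v i = v j -> (i - L < j < i + L)%R -> i = j.
Proof.
move=> [L3 _ inj _] e ij; apply: contrapT => ne.
have [lt|lt] : (i < j)%R \/ (j < i)%R by lia.
  by apply: (inj i j) => //; lia.
by apply: (inj j i) => //; lia.
Qed.

(** The boundary of [F] has one [g]-edge and one [h]-edge, and a simple cycle cannot use an edge
    twice in a period. *)
Lemma cycle_exit L v g h F b i : cayley_cycle L v g h ->
  cuts g F (v (i + 1)%R) -> cuts h F b -> v (i + 1)%R = g * v i ->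
  exists j, [/\ (i < j < i + L)%R, v j = b /\ v j = h * v (j + 1)%R,
    forall k, (i < k <= j)%R -> F (v k)
    & forall k, (j < k <= i + L)%R -> ~ F (v k)].
Proof.
move=> C gF hF step; have [L3 per _ adj] := C.
have nFi : ~ F (v i) by apply: (cuts_source gF).
have Fi1 : F (v (i + 1)%R) by case: gF.
have [|||j [ij nFj Fj]] := @first_exit (F \o v) (i + 1)%R (i + L)%R => //.
- lia.
- by rewrite /= per.
have Fvj : F (v j) by apply: Fj; lia.
have [vjb vjh] : v j = b /\ v j = h * v (j + 1)%R.
  case: (adj j) => -[] e.
  - by case: nFj; rewrite /= e; apply: (cuts_step gF).
  (* Leaving by the [g]-edge would retrace the edge of entry. *)
  - have ej : v j = v (i + 1)%R.
      by rewrite e; apply: (cuts_enter gF nFj); rewrite -e.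
    have eij : j = (i + 1)%R by apply: (cayley_cycle_inj C ej); lia.
    have e2 : v (i + 1 + 1)%R = v i by apply: (mulgI g); rewrite -step -eij.
    by have := cayley_cycle_inj C e2; lia.
  - by case: nFj; rewrite /= e; apply: (cuts_step hF).
  - by split=> //; rewrite e; apply: (cuts_enter hF nFj); rewrite -e.
exists j; split=> //; first lia.
  by move=> k ik; apply: Fj; lia.
(* A return to [F] would visit [v (i + 1)] or [v j] again within the period. *)
move=> k jk Fk.
have jk' : (j + 1 < k)%R.
  suff : k <> (j + 1)%R by lia.
  by move=> e; apply: nFj; rewrite /= -e.
have [//||m [jm Fm1 nFm]] := @first_exit (fun m => ~ F (v m)) (j + 1)%R k jk'.
  by move=> /(_ Fk).
have {}Fm1 : F (v (m + 1)%R) by apply: contrapT.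
have {}nFm : ~ F (v m) by apply: nFm; lia.
case: (adj m) => -[] e.
- have em : v (m + 1)%R = v (i + 1)%R.
    by rewrite e; apply: (cuts_enter gF nFm); rewrite -e.
  by have := cayley_cycle_inj C em; lia.
- by apply: nFm; rewrite e; apply: (cuts_step gF).
- have em : v (m + 1)%R = v j.
    by rewrite vjb e; apply: (cuts_enter hF nFm); rewrite -e.
  by have := cayley_cycle_inj C em; lia.
- by apply: nFm; rewrite e; apply: (cuts_step hF).
Qed.

(** Both boundary edges meet at one vertex of the cut, so the cycle leaves right after entering. *)
Lemma common_cut_next L v g h F x i : cayley_cycle L v g h ->
  cuts g F x -> cuts h^-1 F x -> v (i + 1)%R = g * v i ->
  v (i + 1 + 1)%R = h * v (i + 1)%R.
Proof.
move=> C gF hF step; have [L3 _ _ _] := C.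
have gF' := cuts_translate_to (v (i + 1)%R) gF.
have hF' := cuts_translate_to (v (i + 1)%R) hF.
have [j [ij [vj vjh] _ _]] := cycle_exit (cayley_cycle_invr C) gF' hF' step.
have ej : j = (i + 1)%R by apply: (cayley_cycle_inj C vj); lia.
by rewrite -ej vjh mulVKg.
Qed.

(** Read on the reversed cycle, [common_cut_next] limits the step after [g], [h]: a backward [g]
    would give [h * h = 1], a forward [h] would give [g = h]. *)
Lemma common_cut_alternates L v g h F x i n :
  cayley_cycle L v g h -> g <> h -> h * h <> 1 ->
  cuts g F x -> cuts h^-1 F x -> v (i + 1)%R = g * v i ->
  let k := (i + n.*2%:Z)%R in
  v (k + 1)%R = g * v k /\ v (k + 1 + 1)%R = h * v (k + 1)%R.
Proof.
move=> C gh hh gF hF step; have [L3 _ _ adj] := C.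
elim: n => [|n]; cbv zeta.
  by rewrite GRing.addr0; split=> //; exact: (common_cut_next C gF hF step).
 set k := (i + n.*2%:Z)%R => -[s1 s2].
rewrite (_ : (i + _)%R = (k + 1 + 1)%R); last by rewrite /k; lia.
suff s3 : v (k + 1 + 1 + 1)%R = g * v (k + 1 + 1)%R.
  by split=> //; exact: (common_cut_next C gF hF s3).
have Cr := cayley_cycle_rev C.
have r3 : (- (- (k + 1 + 1 + 1) + 1))%R = (k + 1 + 1)%R by lia.
have r2 : (- (- (k + 1 + 1 + 1) + 1 + 1))%R = (k + 1)%R by lia.
case: (adj (k + 1 + 1)%R) => -[] e //.
- have := @common_cut_next L _ g h F x (- (k + 1 + 1 + 1))%R Cr gF hF.
  rewrite r3 r2 GRing.opprK => /(_ e) e2.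
  by case: hh; apply: (mulIg (v (k + 1)%R)); rewrite -mulgA -s2 -e2 mul1g.
- have Cr' := cayley_cycle_invr (cayley_cycle_invl (cayley_cycle_swap Cr)).
  have gF' : cuts (g^-1)^-1 F x by rewrite invgK.
  have := @common_cut_next L _ h^-1 g^-1 F x (- (k + 1 + 1 + 1))%R Cr' hF gF'.
  rewrite r3 r2 GRing.opprK e mulKg => /(_ erefl) e2.
  by case: gh; apply: (mulIg (v (k + 1)%R)); rewrite -s2 e2 mulVKg.
- have e2 : v (k + 1 + 1 + 1)%R = v (k + 1)%R by apply: (mulgI h); rewrite -e.
  by have := cayley_cycle_inj C e2; lia.
Qed.

(** The difference of [F] and [F1] is a cut for [g] and [h^-1] at one point, so from [v i] on the
    cycle alternates forward [g] and [h]; the backward [h]-step at [v j] contradicts this for either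
    parity of [j - i]. *)
Lemma no_opposite_orientation L v g h F F1 a1 i j :
  cayley_cycle L v g h -> g <> h ->
  cuts g F (v (i + 1)%R) -> cuts h F (v j) ->
  cuts g F1 a1 -> cuts h F1 (v (i + 1 + 1)%R) ->
  (i < j)%R ->
  v (i + 1)%R = g * v i -> v (i + 1 + 1)%R = h * v (i + 1)%R ->
  v j = h * v (j + 1)%R ->
  F1 (v (j + 1)%R) -> ~ F a1 -> False.
Proof.
move=> C gh gF hF gF1 hF1 ij s1 s2 sj F1j nFa1.
have hh : h * h <> 1 by apply: (cuts_mul_neq1 hF hF).
have hg1 : h * g <> 1 by apply: (cuts_mul_neq1 hF gF).
have nF1x : ~ F1 (v (i + 1)%R) by apply: (cuts_source hF1).
have Fx : F (v (i + 1)%R) by case: gF.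
have gB : cuts g (F `\` F1) (v (i + 1)%R) by apply: (cuts_setD gF gF1).
have hB : cuts h^-1 (F `\` F1) (v (i + 1)%R).
  have -> : F `\` F1 = (~` F1) `\` (~` F) by rewrite !setDE setCK setIC.
  have := cuts_setD (cuts_compl hF1) (cuts_compl hF).
  by rewrite s2 sj !mulKg; apply; apply.
have [n en] : exists n : nat, j = (i + n.*2%:Z)%R \/ j = (i + n.*2%:Z + 1)%R.
  by exists (`|j - i|./2); lia.
have [/= e1 e2] := common_cut_alternates n C gh hh gB hB s1.
case: en => en; rewrite -en in e1 e2.
  by apply: hg1; apply: (mulIg (v j)); rewrite -mulgA -e1 -sj mul1g.
by apply: hh; apply: (mulIg (v j)); rewrite -mulgA -e2 -sj mul1g.
Qed.

(** Induction on a bound for [j - i]; the cases are the label and direction of the edge following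
    the entry. *)
Lemma descent n L v g h F i j : cayley_cycle L v g h -> g <> h ->
  cuts g F (v (i + 1)%R) -> cuts h F (v j) ->
  v (i + 1)%R = g * v i -> v j = h * v (j + 1)%R ->
  (i < j < i + L)%R -> (j < i + n%:Z)%R ->
  exists g' E a u, [/\ cuts g' E a, stabilizes E u & u <> 1].
Proof.
elim: n L v g h F i j => [|n IH] L v g h F i j C gh gF hF si sj ij jn.
  lia.
have base F' a : cuts g F' a -> cuts h F' a -> 
    exists g' E a u, [/\ cuts g' E a, stabilizes E u & u <> 1].
  move=> gF' hF'; exists g, F', a, (g^-1 * h); split=> //.
    exact: (stabilizes_divl gF' hF').
  by move=> e; apply: gh; rewrite -(mulVKg g h) e mulg1.
have [L3 per _ adj] := C.
have [j0 [ij0 [vj0 _] inF outF]] := cycle_exit C gF hF si.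
have ej0 : j0 = j by apply: (cayley_cycle_inj C vj0); lia.
rewrite {}ej0 {j0 ij0 vj0} in inF outF.
have [ej|i1j] : j = (i + 1)%R \/ (i + 1 < j)%R by lia.
  by rewrite -ej in gF; apply: (base F (v j)).
case: (adj (i + 1)%R) => -[] s2.
(* If [F1] is left no later than [F], it replaces [F]; otherwise the intersection is entered one
   step later and left at [j]. *)
- have [F1 [b1 [gF1 hF1]]] := cuts_translate2 (v (i + 1 + 1)%R) gF hF.
  have [j1 [ij1 [vj1 sj1] inF1 outF1]] := cycle_exit C gF1 hF1 s2.
  rewrite -vj1 in hF1.
  have [le|lt] : (j1 <= j)%R \/ (j < j1)%R by lia.
    by apply: (IH L v g h F1 (i + 1)%R j1) => //; lia.
  apply: (IH L v g h (F `&` F1) (i + 1)%R j) => //; try lia.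
    rewrite setIC; apply: (cuts_setI gF1 gF); first by apply: inF; lia.
    by rewrite -per; apply: outF1; lia.
  by apply: (cuts_setI hF hF1); [apply: inF1|apply: outF]; lia.
- have e2 : v (i + 1 + 1)%R = v i by apply: (mulgI g); rewrite -s2.
  by have := cayley_cycle_inj C e2; lia.
(* Here [F1] is entered by [h] and left by [g]; an early exit is handled by reversing the cycle, a
   late one is the exceptional pattern. *)
- have [F1 [a1 [hF1 gF1]]] := cuts_translate2 (v (i + 1 + 1)%R) hF gF.
  have [j1 [ij1 [vj1 sj1] inF1 outF1]] :=
    cycle_exit (cayley_cycle_swap C) hF1 gF1 s2.
  have [le|lt] : (j1 <= j)%R \/ (j < j1)%R by lia.
    apply: (IH L (fun k => v (- k)%R) g h F1
      (- (j1 + 1))%R (- (i + 1 + 1))%R) => //; try lia.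
    + exact: cayley_cycle_rev.
    + by rewrite (_ : (- (- (j1 + 1) + 1))%R = j1) ?vj1 //; lia.
    + by rewrite GRing.opprK.
    + by rewrite (_ : (- (- (j1 + 1) + 1))%R = j1) ?GRing.opprK //; lia.
    + rewrite (_ : (- (- (i + 1 + 1) + 1))%R = (i + 1)%R) ?GRing.opprK //; lia.
  exfalso; apply: (no_opposite_orientation C gh gF hF gF1 hF1) => //; first lia.
    by apply: inF1; lia.
  by rewrite -vj1; apply: outF; lia.
(* This edge leaves [F1], so the entry [q] is found by following the cycle backwards. *)
- have [F1 [a1 [hF1 gF1]]] := cuts_translate2 (v (i + 1)%R) hF gF.
  have Cr := cayley_cycle_rev C.
  have r : (- (- (i + 1 + 1) + 1))%R = (i + 1)%R by lia.
  have [] := @cycle_exit L (fun k => v (- k)%R) h g F1 a1 (- (i + 1 + 1))%R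
    (cayley_cycle_swap Cr).
  + by rewrite r.
  + exact: gF1.
  + by rewrite r GRing.opprK.
  move=> j' [ij' [vj' sj'] inF1 outF1].
  pose q := (- j')%R; rewrite -/q in vj' sj'.
  rewrite (_ : (- (j' + 1))%R = (q - 1)%R) in sj'; last by rewrite /q; lia.
  have {}inF1 k : (q <= k <= i + 1)%R -> F1 (v k).
    by move=> qk; rewrite -(GRing.opprK k); apply: inF1; lia.
  have {}outF1 k : (i + 2 - L <= k < q)%R -> ~ F1 (v k).
    by move=> qk; rewrite -(GRing.opprK k); apply: outF1; lia.
  have [lt|ge] : (i + 2 - q < j - i)%R \/ (j - i <= i + 2 - q)%R by lia.
    apply: (IH L v g h F1 (q - 1)%R (i + 1)%R) => //; try lia.
    + by rewrite GRing.subrK vj'.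
    + by rewrite GRing.subrK.
  (* If the visits to [F] and [F1] meet only in [v (i + 1)], both boundary edges of the intersection
     end there. *)
  have [lt|le] : (j < q + L)%R \/ (q + L <= j)%R by lia.
    apply: (base (F `&` F1) (v (i + 1)%R)).
      apply: (cuts_setI gF gF1); first by case: hF1.
      by rewrite -vj' -(per q); apply: outF; lia.
    rewrite setIC; apply: (cuts_setI hF1 hF); first by case: gF.
    have -> : v j = v (j - L)%R by rewrite -(per (j - L)%R) GRing.subrK.
    by apply: outF1; lia.
  have sq : v (- (- (q + L) + 1))%R = g^-1 * v (q + L)%R.
    rewrite (_ : (- _)%R = (q - 1 + L)%R); last lia.
    by rewrite !per sj' mulKg.
  (* F and F1 together cover the cycle: the complement of F1, with the inverse
     generators and the reversed cycle, is entered and left more quickly. *)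
  apply: (IH L (fun k => v (- k)%R) g^-1 h^-1 (~` F1)
    (- (q + L))%R (- (i + 1 + 1))%R) => //; try lia.
  + exact: cayley_cycle_invl (cayley_cycle_invr Cr).
  + by move=> /invg_inj.
  + by rewrite sq per vj'; apply: cuts_compl.
  + have -> : v (- - (i + 1 + 1))%R = h^-1 * v (i + 1)%R.
      by rewrite GRing.opprK s2 mulKg.
    exact: cuts_compl.
  + by rewrite sq GRing.opprK.
  + by rewrite r GRing.opprK s2 mulKg.
Qed.

(** Reversing the cycle or swapping [g] and [h] turns any edge into a forward [g]-edge, and a
    translate of [F] is entered by it. *)
Lemma cycle_stabilizer L v g h F a b : cayley_cycle L v g h -> g <> h ->
  cuts g F a -> cuts h F b ->
  exists g' E a u, [/\ cuts g' E a, stabilizes E u & u <> 1].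
Proof.
have pos v' g1 h1 F1 a1 b1 i : cayley_cycle L v' g1 h1 -> g1 <> h1 ->
    cuts g1 F1 a1 -> cuts h1 F1 b1 -> v' (i + 1)%R = g1 * v' i ->
    exists g' E a u, [/\ cuts g' E a, stabilizes E u & u <> 1].
  move=> C gh gF1 hF1 s.
  have [F2 [b2 [gF2 hF2]]] := cuts_translate2 (v' (i + 1)%R) gF1 hF1.
  have [j [ij [vj sj] _ _]] := cycle_exit C gF2 hF2 s.
  rewrite -vj in hF2.
  by apply: (@descent (absz (j - i + 1)%R) L v' g1 h1 F2 i j) => //; lia.
move=> C gh gF hF; have [_ _ _ /(_ (-1)%R)] := C; rewrite GRing.addNr.
have Cr := cayley_cycle_rev C.
case=> -[] s.
- exact: (pos v g h F a b (-1)%R).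
- exact: (pos _ g h F a b 0%R Cr).
- exact: (pos v h g F b a (-1)%R (cayley_cycle_swap C) (nesym gh)).
- exact: (pos _ h g F b a 0%R (cayley_cycle_swap Cr) (nesym gh)).
Qed.

End Cycles.

(** * From relations to cycles, and the conclusion *)

Lemma shortest_relation (I : eqType) (G : groupType) (f : I -> G) :
  ~ independent f ->
  exists w, [/\ w != [::], reduced w, weval f w = 1
    & forall w', w' != [::] -> reduced w' -> weval f w' = 1 ->
        size w <= size w'].
Proof.
move=> nind.
have ex : exists n, `[< exists w, [/\ w != [::], reduced w, weval f w = 1
                                    & size w = n] >].
  apply: contrapT => none; apply: nind => w w0 red w1; apply: none.
  by exists (size w); apply/asboolP; exists w.
case: (ex_minnP ex) => n /asboolP[w [w0 red w1 sw]] minn.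
exists w; split=> // w' w'0 red' w'1; rewrite sw; apply: minn.
by apply/asboolP; exists w'.
Qed.

Lemma independent_comp (I J : eqType) (G : groupType)
    (e : J -> I) (f : I -> G) :
  injective e -> independent f -> independent (f \o e).
Proof.
move=> e_inj ind w w0 red.
have -> : weval (f \o e) w = weval f [seq (e l.1, l.2) | l <- w].
  by elim: {w0 red} w => //= -[i s] w ->.
apply: ind; first by case: (w) w0.
rewrite /reduced sorted_map; apply: sub_sorted red => -[i s] [j s'] /=.
by rewrite /flip /= !xpair_eqE (inj_eq e_inj).
Qed.

(** The vertices are the values of the suffixes of a shortest relation; a repeated value would cut
    out a shorter one. *)
Lemma relation_cycle (G : groupType) (f : bool -> G) (F : set G) (a b : G) :
  cuts (f true) F a -> cuts (f false) F b -> f true <> f false ->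
  ~ independent f ->
  exists L v, cayley_cycle L v (f true) (f false).
Proof.
move=> aF bF ab /shortest_relation[w [w0 red w1 minw]].
have cutf i : exists c, cuts (f i) F c by case: i; eexists; eassumption.
have f1 i : f i <> 1.
  have [c cF] := cutf i => e; apply: (cuts_source cF (x := c)).
    by rewrite e mul1g.
  by case: cF.
have ff i j : f i * f j <> 1.
  have [[c cF] [d dF]] := (cutf i, cutf j); exact: (cuts_mul_neq1 cF dF).
have f_inj : injective f by case=> -[] // e; case: ab; rewrite e.
have w3 : 2 < size w.
  case: (w) w0 red w1 => [|[i s] [|[j s'] [|l w']]] //= _.
    move=> _; rewrite /letter mulg1 /=; case: s => [/f1//|/(congr1 inv)].
    by rewrite invgK invg1 => /f1.
  rewrite /letter /= mulg1 andbT => red e; case: s s' e red => -[] /=.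
  - by move/ff.
  - by move/divg1_eq/f_inj->; rewrite /flip /= eqxx.
  - by move/mulg1_eq; rewrite invgK => /f_inj->; rewrite /flip /= eqxx.
  - by rewrite -invgM => /(congr1 inv); rewrite invgK invg1 => /ff.
pose u k := weval f (drop k w).
pose v (i : int) := u `|(i %% size w)%Z|.
have u_inj k l : k < l < size w -> u k <> u l.
  move=> kl; rewrite /u -(cat_take_drop (l - k) (drop k w)) weval_cat drop_drop.
  rewrite subnK; last lia.
  move/(congr1 (fun z => z / weval f (drop l w))).
  rewrite mulgK mulgV => e.
  have sz : size (take (l - k) (drop k w)) = (l - k)%N.
    by rewrite size_take size_drop; case: ltnP; lia.
  have /minw : take (l - k) (drop k w) != [::] by rewrite -size_eq0 sz; lia.
  move=> /(_ _ e); rewrite sz => H; suff : size w <= l - k by lia.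
  by apply: H; apply/take_sorted/drop_sorted.
have uS k : k < size w ->
    joined (f true) (u k) (u k.+1) \/ joined (f false) (u k) (u k.+1).
  move=> kw; rewrite /u (drop_nth (true, true)) //=.
  case: (nth _ w k) => -[] []; rewrite /letter /=; [left|left|right|right];
    rewrite /joined ?mulVKg; by [left|right].
have uw : u (size w) = u 0 by rewrite /u drop_size drop0 w1.
exists (size w : int), v; split; first lia.
- by move=> i; rewrite /v; congr (u `|_|%N); rewrite modzDr.
- move=> i j ij e.
  pose k := `|(i %% size w)%Z|; pose l := `|(j %% size w)%Z|.
  have kl : k <> l.
    rewrite /k /l => h.
    have : (i %% size w)%Z = (j %% size w)%Z by lia.
    have := divz_eq i (size w); have := divz_eq j (size w).
    set qi := (i %/ _)%Z; set qj := (j %/ _)%Z => ej ei em.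
    have [le|lt] : (qj <= qi)%R \/ (qi + 1 <= qj)%R by lia.
      by clear - le ej ei em ij w3; nia.
    by clear - lt ej ei em ij w3; nia.
  have kw : k < size w by rewrite /k; lia.
  have lw : l < size w by rewrite /l; lia.
  have [lt|lt] : k < l \/ l < k by lia.
    by apply: (u_inj k l) => //; rewrite lt.
  by apply: (u_inj l k) => //; rewrite lt.
move=> i; rewrite /v.
set k := `|(i %% size w)%Z|.
have kw : k < size w by rewrite /k; lia.
have ek : ((i %% size w)%Z + 1)%R = k.+1 by rewrite /k; lia.
rewrite -modzDml ek modz_nat absz_nat.
have [lt|ge] : k.+1 < size w \/ k.+1 = size w by lia.
  by rewrite modn_small //; apply: uS.
by rewrite ge modnn -uw -ge; apply: uS.
Qed.

Lemma independent_bool_contains_free (G : groupType) (f : bool -> G) :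
  independent f -> contains_free_subgroup 2 G.
Proof.
move=> ind; pose e (i : 'I_2) := i == ord0.
apply: independent_contains_free (independent_comp (e := e) _ ind).
by move=> [[|[|//]] ?] [[|[|//]] ?] // _; apply: val_inj.
Qed.

Theorem corollary1p1 (G : groupType) :
  (exists E : set G, wS_subset E) -> contains_free_subgroup 2 G.
Proof.
move=> [E [g [h [a [b [Ea Eb ab gE hE]]]]]].
have {gE}gF := ltranslate_cuts Ea gE.
have {hE}hF := ltranslate_cuts Eb hE.
pose f i := if i then g else h.
have [/independent_bool_contains_free //|dep] := pselect (independent f).
(* If [g] and [h] were equal, the edges into [a] and [b] would coincide. *)
have gh : g <> h.
  move=> e; rewrite -e in hF; apply: ab; rewrite -(mulVKg g b).
  apply/esym/(cuts_enter gF); last by rewrite mulVKg.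
  by apply: (cuts_source hF); rewrite mulVKg.
have [L [v C]] := @relation_cycle G f E a b gF hF gh dep.
have [k [F [c [u [kF uF u1]]]]] := cycle_stabilizer C gh gF hF.
(* The free generators are [u * k * u^-1] and [k]; [u <> 1] makes [t] injective. *)
pose t (i : bool) := if i then u else 1.
apply: (independent_bool_contains_free (f := fun i => t i * k * (t i)^-1)).
apply: (conjugates_independent kF).
  by case=> // x; rewrite mul1g.
by case=> -[] // e; case: u1.
Qed.
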